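(* Let $A\in\mathbb{C}^{m\times n}$, $B\in\mathbb{C}^{m}_{\mathrm H}$ and $T\in\mathbb{C}^{p\times m}$, and assume that $AXA^*=B$ has a Hermitian solution. Put $$\mathcal{S}=\{X\in\mathbb{C}^{n}_{\mathrm H}\mid AXA^*=B\},\qquad \mathcal{T}=\{Y\in\mathbb{C}^{n}_{\mathrm H}\mid TAYA^*T^*=TBT^*\}.$$ Then: (a) $\mathcal{S}\subseteq\mathcal{T}$ always holds, that is, all Hermitian solutions of $AXA^*=B$ are solutions of $TAXA^*T^*=TBT^*$. (b) $\mathcal{S}=\mathcal{T}$ if and only if $r(TA)=r(A)$, or equivalently, $\mathscr{R}(A^*T^* )=\mathscr{R}(A^* )$.
   Context: $\mathbb{C}^{k}_{\mathrm H}$ is the set of $k\times k$ complex Hermitian matrices. $A^*$, $r(A)$ and $\mathscr{R}(A)$ denote the conjugate transpose, rank and range (column space) of $A$. *)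

(* Defs.v *)
From HB Require Import structures.
From mathcomp Require Export all_boot all_order all_algebra.
From mathcomp Require Export classical_sets reals.
From mathcomp Require Export complex.

Set Implicit Arguments.
Unset Strict Implicit.
Unset Printing Implicit Defensive.

Import Order.TTheory GRing.Theory Num.Theory.

Local Open Scope ring_scope.
Local Open Scope classical_set_scope.

(* [R : realType] being the real numbers, [R[i]] is the field of complex
   numbers; [M ^t*] is the conjugate transpose and [hermsymmx] the predicate
   [M = M ^t*] (up to a factor [(-1) ^+ false]). *)

(* Column space; [mxalgebra] subspaces such as [<<M>>%MS] are row spaces. *)
Definition mxrange (R : realType) (m n : nat) (M : 'M[R[i]]_(m, n)) :
    set 'cV[R[i]]_m :=
  range (fun x : 'cV[R[i]]_n => M *m x).

(* Main.v *)
Require Import Defs.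

Set Implicit Arguments.
Unset Strict Implicit.
Unset Printing Implicit Defensive.

Import GRing.Theory Num.Theory.
Local Open Scope ring_scope.
Local Open Scope classical_set_scope.
Local Open Scope sesquilinear_scope.

(** Both rank equality and range equality say the same thing about row spaces:
    that [A] lies in the row space of [T *m A], i.e. that [A = D *m (T *m A)]
    for some [D], so that [T] can be cancelled on the left of [A] (see
    [mxrank_mulmx_eq] and [mxrange_trmxC_sub]).

    If [T] can be cancelled, multiplying the compressed equation by [D] on the
    left and by [D ^t*] on the right turns [T *m A *m Y *m A ^t* *m T ^t*] into
    [A *m Y *m A ^t*].  The right-hand side [T *m B *m T ^t*] becomes [B]
    because consistency makes [B] itself of the form [A *m X *m A ^t*].

    Conversely, let the columns of [K] span the kernel of [T *m A].  Adding the
    Hermitian matrix [K *m K ^t*] to a solution [X] of the original equation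
    preserves the compressed one; if the two solution sets agree, it also
    preserves the original one, whence [(A *m K) *m (A *m K) ^t* = 0].  By
    positivity [A *m K = 0]: the kernel of [T *m A] is contained in that of
    [A], which is again the inclusion of row spaces (see
    [submx_of_herm_solutions]). *)

Section ConjugateTranspose.
Variable C : numClosedFieldType.

Lemma trmxC_mul m n p (M : 'M[C]_(m, n)) (N : 'M[C]_(n, p)) :
  (M *m N) ^t* = N ^t* *m M ^t*.
Proof. by rewrite trmx_mul map_mxM. Qed.

Lemma hermsymmxP n (X : 'M[C]_n) : reflect (X ^t* = X) (X \is hermsymmx).
Proof.
by apply: (iffP (is_hermitianmxP _ _ X)); rewrite expr0 scale1r => /esym.
Qed.

Lemma hermsymmx_add_gram m n (X : 'M[C]_m) (K : 'M[C]_(m, n)) :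
  X \is hermsymmx -> X + K *m K ^t* \is hermsymmx.
Proof.
move=> /hermsymmxP hX; apply/hermsymmxP.
by rewrite linearD /= map_mxD hX trmxC_mul trmxCK.
Qed.

(** The hypothesis says that the row space of [M] is orthogonal to itself, and
    the Hermitian form is definite. *)
Lemma gram_eq0 m n (M : 'M[C]_(m, n)) : M *m M ^t* = 0 -> M = 0.
Proof.
move=> /orthomx1P ortho_M; apply/eqP; rewrite -submx0.
by rewrite -(orthomx_ortho_disj M) sub_capmx submx_refl.
Qed.

End ConjugateTranspose.

Lemma mxrank_mulmx_eq (F : fieldType) m n p
    (T : 'M[F]_(p, m)) (A : 'M[F]_(m, n)) :
  \rank (T *m A) = \rank A <-> (A <= T *m A)%MS.
Proof.
have [_ rankE] := mxrank_leqif_sup (submxMl T A).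
by rewrite -rankE; split => /eqP.
Qed.

Section HermitianSolutions.
Variable C : numClosedFieldType.
Variables (m n p : nat).
Variables (A : 'M[C]_(m, n)) (T : 'M[C]_(p, m)).

Lemma mulmx_congrC_cancel (Y Z : 'M[C]_n) :
  (A <= T *m A)%MS ->
  T *m A *m Y *m A ^t* *m T ^t* = T *m A *m Z *m A ^t* *m T ^t* ->
  A *m Y *m A ^t* = A *m Z *m A ^t*.
Proof.
move=> /submxP[D defA] eqYZ.
have congrE V : A *m V *m A ^t* = D *m (T *m A *m V *m A ^t* *m T ^t*) *m D ^t*.
  by rewrite [in LHS]defA !trmxC_mul !mulmxA.
by rewrite !congrE eqYZ.
Qed.

(** One Hermitian perturbation of [X] is enough to detect the kernel: the Gram
    matrix of a spanning family of the kernel of [T *m A]. *)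
Lemma submx_of_herm_solutions (X : 'M[C]_n) :
  X \is hermsymmx ->
  (forall Y : 'M[C]_n, Y \is hermsymmx ->
     T *m A *m Y *m A ^t* *m T ^t* = T *m A *m X *m A ^t* *m T ^t* ->
     A *m Y *m A ^t* = A *m X *m A ^t*) ->
  (A <= T *m A)%MS.
Proof.
move=> hX cancelX; rewrite submxE.
move: (cokermx _) (mulmx_coker (T *m A)) => K TAK0.
have := cancelX _ (hermsymmx_add_gram K hX).
rewrite !mulmxDr !mulmxDl !mulmxA TAK0 !mul0mx addr0 => /(_ erefl)/eqP.
rewrite -subr_eq0 addrC addKr => /eqP AKKA0.
by apply/eqP/gram_eq0; rewrite trmxC_mul !mulmxA.
Qed.

End HermitianSolutions.

(** Conjugate transposition turns column spaces into row spaces. *)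
Lemma mxrange_trmxC_sub (R : realType) m n p
    (M : 'M[R[i]]_(m, n)) (N : 'M[R[i]]_(p, n)) :
  mxrange (M ^t*) `<=` mxrange (N ^t*) <-> (M <= N)%MS.
Proof.
split=> [subMN | /submxP[D ->] _ [x _ <-]]; last first.
  by exists (D ^t* *m x) => //; rewrite trmxC_mul mulmxA.
apply/row_subP => k.
(* The [k]-th row of [M] is the conjugate transpose of a column of [M ^t*]. *)
have [|y _ Ny] := subMN (M ^t* *m (delta_mx 0 k) ^t*); first by eexists.
apply/submxP; exists (y ^t*); rewrite rowE -[LHS]trmxCK trmxC_mul.
by rewrite -Ny trmxC_mul trmxCK.
Qed.

Lemma mxrange_trmxC_mulmx_eq (R : realType) m n p
    (A : 'M[R[i]]_(m, n)) (T : 'M[R[i]]_(p, m)) :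
  mxrange (A ^t* *m T ^t*) = mxrange (A ^t*) <-> (A <= T *m A)%MS.
Proof.
rewrite -trmxC_mul -mxrange_trmxC_sub; split=> [-> //|subA].
by apply/seteqP; split=> //; apply/mxrange_trmxC_sub/submxMl.
Qed.

Theorem theorem4p1 (R : realType) (m n p : nat)
    (A : 'M[R[i]]_(m, n)) (B : 'M[R[i]]_m) (T : 'M[R[i]]_(p, m))
    (hB : B \is hermsymmx)
    (hsol : exists X : 'M[R[i]]_n,
      X \is hermsymmx /\ A *m X *m A ^t* = B) :
  let solS : set 'M[R[i]]_n :=
    [set X | X \is hermsymmx /\ A *m X *m A ^t* = B] in
  let solT : set 'M[R[i]]_n :=
    [set Y | Y \is hermsymmx /\
             T *m A *m Y *m A ^t* *m T ^t* = T *m B *m T ^t*] in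
  solS `<=` solT /\
  ((solS = solT <-> \rank (T *m A) = \rank A) /\
   (\rank (T *m A) = \rank A <->
    mxrange (A ^t* *m T ^t*) = mxrange (A ^t*))).
Proof.
move=> solS solT; have [X [hX defB]] := hsol.
have subST : solS `<=` solT.
  by move=> Y [hY eqY]; split=> //; rewrite -eqY !mulmxA.
split=> //; split; last by rewrite mxrank_mulmx_eq mxrange_trmxC_mulmx_eq.
rewrite mxrank_mulmx_eq; split=> [eqST | cancelT].
  apply: (submx_of_herm_solutions hX) => Y hY eqY.
  have : solT Y by split=> //; rewrite eqY -defB !mulmxA.
  by rewrite -eqST => -[_ ->].
apply/seteqP; split=> // Y [hY eqY]; split=> //.
rewrite -defB; apply: (mulmx_congrC_cancel cancelT).
by rewrite eqY -defB !mulmxA.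
Qed.
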